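(* Let $\Gamma$ be a tree on a finite set $\Pi$, and let $\{\Pi_1,\Pi_2\}$ be a principal decomposition of $\Gamma$. Let $\sigma(\Gamma):=\max\{\sigma(p)\mid p\in Or(\Gamma)\}$. Then for $o\in Or(\Gamma)$ one has $\sigma(o)=\sigma(\Gamma)$ if and only if $o$ is one of the two principal orientations $o_{\Pi_1,\Pi_2}$ or $o_{\Pi_2,\Pi_1}$. In other words, the principal $\Gamma$-cones are exactly the $\Gamma$-cones containing the (strictly) maximal number of chambers.
   Context: For a finite set $\Pi$ with $\#\Pi=l\ge1$, $V_\Pi:=\bigoplus_{\alpha\in\Pi}\mathbb{R}v_\alpha/\mathbb{R}\sum_\alpha v_\alpha$, with linear forms $\lambda_{\alpha\beta}=\lambda_\alpha-\lambda_\beta$ (dual basis differences) and hyperplanes $H_{\alpha\beta}=\{\lambda_{\alpha\beta}=0\}$. Chambers are the connected components of $V_\Pi\setminus\bigcup_{\alpha\ne\beta}H_{\alpha\beta}$; they correspond bijectively to linear orderings of $\Pi$. For a graph $\Gamma$ on $\Pi$, a $\Gamma$-cone is a connected component of $V_\Pi\setminus\bigcup_{\overline{\alpha\beta}\in Edge(\Gamma)}H_{\alpha\beta}$; these correspond bijectively to acyclic orientations $o$ of $\Gamma$ (a direction $\alpha<_o\beta$ on each edge, with no directed cycle) via $E_o=\{v\mid\lambda_{\alpha\beta}(v)<0$ for every edge oriented $\alpha<_o\beta\}$. $Or(\Gamma)$ is the set of acyclic orientations. $\sigma(o)$ is the number of chambers in $E_o$, equivalently the number of linear orderings $c$ of $\Pi$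 such that $\alpha<_c\beta$ for every edge oriented $\alpha<_o\beta$. A principal decomposition of a tree $\Gamma$ is an ordered pair $\{\Pi_1,\Pi_2\}$ with $\Pi=\Pi_1\sqcup\Pi_2$ such that no edge of $\Gamma$ joins two vertices of the same $\Pi_i$ (a tree has exactly two, $\{\Pi_1,\Pi_2\}$ and $\{\Pi_2,\Pi_1\}$). The principal orientation $o_{\Pi_1,\Pi_2}$ orients every edge $\overline{\alpha\beta}$ with $\alpha\in\Pi_1,\beta\in\Pi_2$ as $\alpha<\beta$; the principal $\Gamma$-cones are $E_{o_{\Pi_1,\Pi_2}}$ and $E_{o_{\Pi_2,\Pi_1}}=-E_{o_{\Pi_1,\Pi_2}}$. *)

(* Defs.v *)
From HB Require Import structures.
From mathcomp Require Import all_boot all_order all_algebra finmap.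
From mathcomp Require Import all_classical all_reals topology normedtype.

Set Implicit Arguments.
Unset Strict Implicit.
Unset Printing Implicit Defensive.

Import Order.TTheory GRing.Theory Num.Theory.
Import numFieldNormedType.Exports.

Local Open Scope classical_set_scope.
Local Open Scope ring_scope.

(** Graphs on [Pi] are given by their adjacency relation. *)

Section Graphs.
Variables (Pi : finType) (e : rel Pi).

Definition is_tree : Prop :=
  [/\ (0 < #|Pi|)%N,
      symmetric e /\ irreflexive e,
      (forall a b, connect e a b)
    & (forall s : seq Pi, uniq s -> (2 < size s)%N -> ~~ cycle e s)].

(** An orientation is the set of its arcs; [(a, b) \in o] reads [a <_o b]. *)
Definition is_orientation (o : {set Pi * Pi}) : bool :=
  [forall a, forall b, ((a, b) \in o) == e a b && ((b, a) \notin o)].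

(** A closed directed walk always contains a simple directed cycle, so the
    cycles need not be required to be duplicate-free. *)
Definition is_acyclic (o : {set Pi * Pi}) : Prop :=
  forall s : seq Pi, s <> [::] -> ~~ cycle (fun a b => (a, b) \in o) s.

Definition Or : {set {set Pi * Pi}} :=
  [set o | is_orientation o && `[< is_acyclic o >]]%SET.

Definition principal_decomposition (P1 P2 : {set Pi}) : Prop :=
  [/\ (P1 :|: P2)%SET = [set: Pi]%SET,
      [disjoint P1 & P2]%B
    & forall a b, e a b ->
        ~ (a \in P1 /\ b \in P1) /\ ~ (a \in P2 /\ b \in P2)].

Definition principal_orientation (P1 P2 : {set Pi}) : {set Pi * Pi} :=
  [set ab | [&& e ab.1 ab.2, ab.1 \in P1 & ab.2 \in P2]]%SET.

End Graphs.

(** The space [R^Pi] with basis [v_a], as functions with the product topology;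
    [lambda_a] is evaluation at [a]. *)
Definition coords (R : realType) (Pi : finType) : Type := Pi -> R.

HB.instance Definition _ (R : realType) (Pi : finType) :=
  GRing.Lmodule.copy (coords R Pi) (Pi -> R).
HB.instance Definition _ (R : realType) (Pi : finType) :=
  Topological.copy (coords R Pi) {ptws Pi -> R}.

Section Space.
Variables (R : realType) (Pi : finType).

(** The line spanned by the sum of the [v_a], i.e. the constant functions. *)
Definition diagonal : {pred coords R Pi} :=
  fun x => `[< exists r : R, forall a, x a = r >].

Lemma diagonal_zmod_closed : zmod_closed diagonal.
Proof.
split; first by apply/asboolP; exists 0.
move=> x y /asboolP[r xr] /asboolP[s ys]; apply/asboolP; exists (r - s) => a.
by rewrite -(xr a) -(ys a).
Qed.

HB.instance Definition _ :=
  GRing.isZmodClosed.Build (coords R Pi) diagonal diagonal_zmod_closed.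

Definition VPi :=
  quotient_topology {ideal_quot diagonal}.

(** Computed on a representative; [lambda_pi] below shows that the choice of
    representative does not matter. *)
Definition lambda (a b : Pi) (v : VPi) : R :=
  (repr v : coords R Pi) a - (repr v : coords R Pi) b.

Definition hyperplane (a b : Pi) : set VPi := [set v | lambda a b v = 0].

Definition complement (e : rel Pi) : set VPi :=
  ~` \bigcup_(ab in [set ab : Pi * Pi | e ab.1 ab.2]) hyperplane ab.1 ab.2.

Definition cones (e : rel Pi) : set (set VPi) :=
  connected_component (complement e) @` complement e.

Definition chambers : set (set VPi) := cones (fun a b => a != b).

(** There are finitely many chambers, so [fset_set] does not take its junk
    value here. *)
Definition nchambers (E : set VPi) : nat :=
  #|` fset_set [set C | chambers C /\ C `<=` E]|.

Definition cone_of (o : {set Pi * Pi}) : set VPi :=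
  [set v | forall a b, (a, b) \in o -> lambda a b v < 0].

Definition sigma (o : {set Pi * Pi}) : nat := nchambers (cone_of o).

Definition sigma_max (e : rel Pi) : nat := (\max_(p in Or e) sigma p)%N.

End Space.

Arguments complement R {Pi} e.
Arguments cones R {Pi} e.
Arguments cone_of R {Pi} o.
Arguments sigma R {Pi} o.
Arguments sigma_max R {Pi} e.

Lemma lambda_pi (R : realType) (Pi : finType) (a b : Pi) (x : coords R Pi) :
  lambda a b (\pi_(VPi R Pi) x)%qT = x a - x b.
Proof.
have /asboolP[r xr] : (x - repr (\pi_(VPi R Pi) x)%qT) \in @diagonal R Pi.
  by rewrite Quotient.idealrBE reprK.
have E c : x c = r + (repr (\pi_(VPi R Pi) x)%qT : coords R Pi) c.
  by apply/eqP; rewrite -subr_eq; apply/eqP; exact: (xr c).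
by rewrite /lambda !E opprD addrACA subrr add0r.
Qed.

(* Main.v *)
Require Import Defs.
From mathcomp Require Import all_boot all_order all_algebra finmap.
From mathcomp Require Import all_classical all_reals topology normedtype.
From mathcomp Require Import zify ring lra.

Set Implicit Arguments.
Unset Strict Implicit.
Unset Printing Implicit Defensive.

Import Order.TTheory GRing.Theory Num.Theory.
Import numFieldNormedType.Exports.

(** Chambers in the cone of [o] correspond to the linear extensions of [o].
    If [o] is not principal, some vertex [v] has both an arc [d < v] and an arc
    [v < u]. Let [Y] be the union of the branches at [v] through its lower
    neighbours, [Z = v |: Y], and let [o'] be [o] with all arcs inside [Z]
    reversed. Then [o'] has strictly more linear extensions than [o]: for a
    linear extension [c] of [o], reversing the order of the elements of [Y]
    within the positions they occupy gives a linear extension of [o'] unless [v]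
    comes after more than half of [Y]; in that case reversing [Z] within its
    positions does, because it moves [v] down. The resulting map is injective,
    and it misses every linear extension of [o'] that starts with [v] and ends
    with [Y]. Hence a maximal orientation has no mixed vertex, and on a connected
    graph it is principal; the two principal orientations are opposite, so they
    have equally many linear extensions. *)

(** * Reversing the order inside a set of positions *)

Section OrderReversal.
Variable n : nat.
Implicit Types (Q : {set 'I_n}) (i j : 'I_n).

(** Order-reversing involution of [Q], extended by the identity: outside [Q] the index runs past the
    end and [nth] returns its default [i]. *)
Definition rev_in Q i : 'I_n := nth i (rev (enum Q)) (index i (enum Q)).

Lemma rev_in_out Q i : i \notin Q -> rev_in Q i = i.
Proof.
by move=> iQ; rewrite /rev_in nth_default // size_rev memNindex ?mem_enum.
Qed.

Lemma index_enum_lt Q i : i \in Q -> index i (enum Q) < #|Q|.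
Proof. by move=> iQ; rewrite cardE index_mem mem_enum. Qed.

Lemma index_enum_rev_lt Q i : i \in Q ->
  #|Q| - (index i (enum Q)).+1 < size (enum Q).
Proof. by move=> /index_enum_lt si; rewrite -cardE ltn_subrL (leq_trans _ si). Qed.

Lemma rev_inE Q i : i \in Q ->
  rev_in Q i = nth i (enum Q) (#|Q| - (index i (enum Q)).+1).
Proof. by move=> iQ; rewrite /rev_in nth_rev -cardE ?index_enum_lt. Qed.

Lemma index_rev_in Q i : i \in Q ->
  index (rev_in Q i) (enum Q) = #|Q| - (index i (enum Q)).+1.
Proof.
by move=> iQ; rewrite rev_inE // index_uniq ?enum_uniq ?index_enum_rev_lt.
Qed.

Lemma rev_in_mem Q i : (rev_in Q i \in Q) = (i \in Q).
Proof.
have [iQ|iQ] := boolP (i \in Q); last by rewrite rev_in_out // (negbTE iQ).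
by rewrite -mem_enum rev_inE // mem_nth // index_enum_rev_lt.
Qed.

Lemma rev_inK Q : involutive (rev_in Q).
Proof.
move=> i; have [iQ|iQ] := boolP (i \in Q); last by rewrite !rev_in_out.
have := index_enum_lt iQ => si.
rewrite (@rev_inE _ (rev_in Q i)) ?rev_in_mem // index_rev_in //.
rewrite (_ : _ - _ = index i (enum Q)); last lia.
by rewrite (set_nth_default i) -?cardE // nth_index // mem_enum.
Qed.

Lemma ltn_index_enum Q i j : i \in Q -> j \in Q ->
  (index i (enum Q) < index j (enum Q)) = (i < j).
Proof.
have sQ : sorted ltn (map val (enum Q)).
  rewrite sorted_map {1}/enum_mem -enumT; apply: sorted_filter.
    by move=> x y z; apply: ltn_trans.
  by rewrite -sorted_map val_enum_ord iota_ltn_sorted.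
have mono x y : x \in Q -> y \in Q -> index x (enum Q) < index y (enum Q) -> x < y.
  move=> xQ yQ; rewrite -(index_map val_inj) -(index_map val_inj _ y).
  by apply: (sorted_ltn_index ltn_trans sQ); rewrite map_f ?mem_enum.
move=> iQ jQ; case: (ltngtP (index i (enum Q)) (index j (enum Q))) => ij.
- by rewrite mono.
- by have := mono _ _ jQ iQ ij; lia.
- by rewrite -(nth_index i (_ : i \in enum Q)) ?mem_enum // ij nth_index ?mem_enum // ltnn.
Qed.

Lemma rev_in_lt Q i j : i \in Q -> j \in Q -> (rev_in Q i < rev_in Q j) = (j < i).
Proof.
move=> iQ jQ; rewrite -!(@ltn_index_enum Q) ?rev_in_mem // !index_rev_in //.
by have := index_enum_lt iQ; have := index_enum_lt jQ; lia.
Qed.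

End OrderReversal.

(** * Linear orders as injective position functions, and ranks in a subset *)

Section LinearOrders.
Variable Pi : finType.
Implicit Types (o : {set Pi * Pi}) (S : {set Pi}) (c : {ffun Pi -> 'I_#|Pi|}).

Definition linear_exts o : {set {ffun Pi -> 'I_#|Pi|}} :=
  [set c : {ffun Pi -> 'I_#|Pi|} | injectiveb c &
    [forall a, forall b, ((a, b) \in o) ==> (c a < c b)]]%SET.

Lemma linear_extsP o c :
  reflect (injective c /\ forall a b, (a, b) \in o -> c a < c b)
    (c \in linear_exts o).
Proof.
rewrite inE; apply: (iffP andP) => -[/injectiveP cI H]; split=> //.
  by move=> a b ab; move/forallP/(_ a)/forallP/(_ b)/implyP: H; apply.
by apply/forallP => a; apply/forallP => b; apply/implyP/H.
Qed.

(** The element [a] may lie outside [S]: below, [v] is ranked in [Y]. *)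
Definition rank_in S c a := #|[set y in S | c y < c a]%SET|.

Lemma rank_in_ltn S c a b : injective c -> a \in S ->
  (rank_in S c a < rank_in S c b) = (c a < c b).
Proof.
move=> cI aS; apply/idP/idP; last first.
  move=> ab; apply/proper_card/properP; split.
    by apply/fintype.subsetP => y; rewrite !inE => /andP[-> /= ya]; exact: ltn_trans ya ab.
  by exists a; rewrite !inE ?aS ?ab ?ltnn ?andbF.
apply: contraLR; rewrite -!leqNgt => ba; apply/subset_leq_card/fintype.subsetP => y.
by rewrite !inE => /andP[-> /= yb]; exact: leq_trans yb ba.
Qed.

Lemma rank_in_setU1 S c v : v \notin S -> rank_in (v |: S) c v = rank_in S c v.
Proof.
move=> vS; apply: eq_card => y; rewrite !inE.
by case: eqVneq => [->|//]; rewrite ltnn !andbF.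
Qed.

(** A rank depends only on the positions that [S] occupies and on the position looked at, so it can
    be compared across two orders and two elements. *)
Lemma rank_in_im S c c' a b : injective c -> injective c' ->
  (c' @: S = c @: S)%SET -> c' b = c a -> rank_in S c' b = rank_in S c a.
Proof.
move=> cI c'I im ca; have R (f : {ffun Pi -> 'I_#|Pi|}) x : injective f ->
    rank_in S f x = #|[set p in (f @: S)%SET | p < f x]%SET|.
  move=> fI; rewrite /rank_in -[LHS](card_imset _ fI); apply: eq_card => p.
  apply/imsetP/idP => [[y + ->]|].
    by rewrite !inE => /andP[yS ->]; rewrite imset_f.
  by rewrite inE => /andP[/imsetP[y yS ->] H]; exists y; rewrite // inE yS.
by rewrite !R // im ca.
Qed.

(** [S] splits into the elements before [a] under [c], those after it, which [c'] puts before [a],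
    and possibly [a] itself. *)
Lemma rank_in_anti S c c' a : injective c ->
  (forall y, y \in S -> (c' y < c' a) = (c a < c y)) ->
  rank_in S c' a + rank_in S c a + (a \in S) = #|S|.
Proof.
move=> cI anti; rewrite -(cardsID [set y | c y < c a]%SET S) addnC [RHS]addnC.
have -> : (#|S :&: [set y | c y < c a]| = rank_in S c a)%SET.
  by apply: eq_card => y; rewrite !inE.
rewrite [in LHS]addnA; congr (_ + _).
rewrite (cardsD1 a (S :\: _)) !inE ltnn /=; congr (_ + _).
apply: eq_card => y; rewrite !inE andbC.
have [yS|] := boolP (y \in S); last by rewrite !andbF.
rewrite /= anti // -leqNgt ltn_neqAle; rewrite !andbT; congr (_ && _).
by rewrite eq_sym (inj_eq val_inj) (inj_eq cI).
Qed.

Lemma rank_inT c a : injective c -> rank_in [set: Pi]%SET c a = c a.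
Proof.
move=> cI; rewrite /rank_in -[LHS](card_imset _ cI).
have [g _ gK] : bijective c by apply: inj_card_bij; rewrite ?card_ord.
transitivity #|[set i : 'I_#|Pi| | i < c a]%SET|.
  apply: eq_card => p; rewrite inE; apply/imsetP/idP => [[y + ->]|].
    by rewrite !inE.
  by move=> H; exists (g p); rewrite ?gK // !inE gK.
have le : c a <= #|Pi| by apply: ltnW.
have wI : injective (widen_ord le) by move=> i j /(congr1 val)/= /val_inj.
rewrite -[RHS]card_ord -[RHS]cardsT -[RHS](card_imset _ wI).
apply: eq_card => i; rewrite inE; apply/idP/imsetP => [ia|[j _ ->]].
  by exists (Ordinal ia) => //; apply: val_inj.
exact: (ltn_ord j).
Qed.

Lemma eq_linear_order c c' : injective c -> injective c' ->
  (forall a b, (c a < c b) = (c' a < c' b)) -> c = c'.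
Proof.
move=> cI c'I H; apply/ffunP => a; apply: val_inj.
by rewrite /= -!rank_inT //; apply: eq_card => b; rewrite !inE H.
Qed.

(** Counting the smaller keys compresses the key to consecutive positions; this builds orders from
    explicit formulas. *)
Lemma linear_order_of_key (k : Pi -> nat) : injective k ->
  exists c, injective c /\ forall a b, (c a < c b) = (k a < k b).
Proof.
move=> kI; have lt a : #|[set b | k b < k a]%SET| < #|Pi|.
  rewrite -cardsT; apply/proper_card/properP; split; first exact: finset.subsetT.
  by exists a; rewrite !inE ?ltnn.
exists [ffun a => Ordinal (lt a)].
have H a b : ([ffun a => Ordinal (lt a)] a < [ffun a => Ordinal (lt a)] b)
    = (k a < k b).
  rewrite !ffunE /=; apply/idP/idP; last first.
    move=> ab; apply/proper_card/properP; split.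
      by apply/fintype.subsetP => y; rewrite !inE => /ltn_trans; apply.
    by exists a; rewrite !inE ?ltnn.
  apply: contraLR; rewrite -!leqNgt => ba.
  by apply/subset_leq_card/fintype.subsetP => y; rewrite !inE => /leq_trans; apply.
split=> // a b ab; apply: kI.
have := H a b; have := H b a; rewrite ab ltnn; lia.
Qed.

End LinearOrders.

(** * Reversing a linear order on a subset *)

Section Reverse.
Variable Pi : finType.
Implicit Types (S : {set Pi}) (c : {ffun Pi -> 'I_#|Pi|}).

Definition reverse_on S c : {ffun Pi -> 'I_#|Pi|} :=
  [ffun a => rev_in (c @: S)%SET (c a)].

Lemma reverse_on_inj S c : injective c -> injective (reverse_on S c).
Proof. by move=> cI a b; rewrite !ffunE => /(inv_inj (rev_inK _))/cI. Qed.

Lemma reverse_on_out S c a : injective c -> a \notin S -> reverse_on S c a = c a.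
Proof. by move=> cI aS; rewrite ffunE rev_in_out // mem_imset. Qed.

(** [rev_in] permutes the occupied positions. This invariance lets a second reversal undo the
    first. *)
Lemma reverse_on_im S c : (reverse_on S c @: S = c @: S)%SET.
Proof.
have sub : (reverse_on S c @: S \subset c @: S)%SET.
  by apply/fintype.subsetP => _ /imsetP[a aS ->]; rewrite ffunE rev_in_mem imset_f.
apply/eqP; rewrite finset.eqEsubset sub /=; apply/fintype.subsetP => p pS.
have : rev_in (c @: S)%SET p \in (c @: S)%SET by rewrite rev_in_mem.
case/imsetP => a aS E; apply/imsetP; exists a => //.
by rewrite ffunE -E rev_inK.
Qed.

Lemma reverse_onK S : involutive (reverse_on S).
Proof.
by move=> c; apply/ffunP => a; rewrite ffunE reverse_on_im ffunE rev_inK.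
Qed.

Lemma reverse_on_lt S c a b : a \in S -> b \in S ->
  (reverse_on S c a < reverse_on S c b) = (c b < c a).
Proof. by move=> aS bS; rewrite !ffunE rev_in_lt // imset_f. Qed.

Lemma reverse_on_val S c a : a \in S -> exists2 b, b \in S & reverse_on S c a = c b.
Proof.
move=> aS; have : reverse_on S c a \in (c @: S)%SET by rewrite -reverse_on_im imset_f.
by case/imsetP => b bS ->; exists b.
Qed.

End Reverse.

(** * Flipping the arcs below a mixed vertex *)

Section Flip.
Variables (Pi : finType) (o : {set Pi * Pi}) (v : Pi) (Y : {set Pi}).
Hypothesis vY : v \notin Y.
Hypothesis inY : forall a b, (a, b) \in o -> b \in Y -> a \in Y.
Hypothesis outY : forall a b, (a, b) \in o -> a \in Y -> (b \in Y) || (b == v).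
Hypothesis belowY : forall a, (a, v) \in o -> a \in Y.
Implicit Types c w : {ffun Pi -> 'I_#|Pi|}.

Let Z := (v |: Y)%SET.

Definition flip_below : {set Pi * Pi} :=
  [set ab | if (ab.1 \in Z) && (ab.2 \in Z)
            then (ab.2, ab.1) \in o else ab \in o]%SET.

Lemma flip_belowE a b : ((a, b) \in flip_below) =
  if (a \in Z) && (b \in Z) then (b, a) \in o else (a, b) \in o.
Proof. by rewrite inE. Qed.

Let vZ : v \in Z. Proof. exact: setU11. Qed.
Let YZ a : a \in Y -> a \in Z. Proof. by move=> aY; rewrite !inE aY orbT. Qed.

(** Arcs of [o] never enter [Y] from outside and leave it only towards [v], whose lower neighbours
    lie in [Y]. Hence an unreversed arc avoids [Y] and does not end at [v], though it may start
    there. *)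
Lemma flip_below_arc a b : (a, b) \in flip_below ->
  [\/ [/\ a \in Y, b \in Y & (b, a) \in o],
      [/\ a = v, b \in Y & (b, v) \in o] |
      [/\ a \notin Y, b \notin Z & (a, b) \in o]].
Proof.
rewrite flip_belowE; case: ifP => [/andP[aZ bZ] ba|/negbT nab ab].
  move: aZ bZ; rewrite !inE => /orP[/eqP av|aY] /orP[/eqP bv|bY].
  - by move: ba; rewrite av bv => /belowY; rewrite (negbTE vY).
  - by apply: Or32; rewrite av in ba *.
  - by move: (inY ba aY); rewrite bv (negbTE vY).
  - exact: Or31.
have [aY|aY] := boolP (a \in Y).
  have := outY ab aY; move: nab; rewrite !inE aY orbT /=.
  by case: eqP => //= _ /negbTE->.
have bY : b \notin Y by apply: contra aY; exact: inY.
apply: Or33; split=> //; rewrite !inE (negbTE bY) orbF.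
by apply: contra aY => /eqP bv; apply: belowY; rewrite -bv.
Qed.

Lemma rank_reverse_below c a : injective c -> a \in Y ->
  (rank_in Y (reverse_on Y c) a + rank_in Y c a).+1 = #|Y|.
Proof.
move=> cI aY; rewrite -(@rank_in_anti _ Y c (reverse_on Y c) a) ?aY ?addn1 //.
by move=> y yY; rewrite reverse_on_lt.
Qed.

Lemma rank_reverse_below_v c : injective c ->
  rank_in Y (reverse_on Y c) v = rank_in Y c v.
Proof.
move=> cI; apply: rank_in_im => //; first exact: reverse_on_inj.
  exact: reverse_on_im.
exact: reverse_on_out.
Qed.

Lemma rank_reverse c a : injective c -> a \in Z ->
  rank_in Y (reverse_on Z c) a + rank_in Y c a + (a \in Y) = #|Y|.
Proof.
move=> cI aZ; apply: rank_in_anti => //.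
by move=> y yY; rewrite reverse_on_lt // YZ.
Qed.

(** Reversing [Y] complements the rank of [d] to [#|Y| - 1] and keeps that of [v], so the inequality
    says that [v] then precedes its old lower neighbours. *)
Lemma reverse_below_ext c : c \in linear_exts o ->
    (forall d, (d, v) \in o -> rank_in Y c v + rank_in Y c d < #|Y|) ->
  reverse_on Y c \in linear_exts flip_below.
Proof.
move=> /linear_extsP[cI co] H; have rI := @reverse_on_inj _ Y c cI.
apply/linear_extsP; split=> // a b /flip_below_arc[[aY bY ba]|[-> bY bv]|[aY bZ ab]].
- by rewrite reverse_on_lt // co.
- rewrite ltnNge leq_eqVlt -(rank_in_ltn _ rI bY) rank_reverse_below_v // negb_or.
  have := rank_reverse_below cI bY; have := H _ bv => lt eq.
  rewrite -leqNgt (_ : _ <= _); last lia.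
  rewrite andbT (inj_eq val_inj) (inj_eq rI).
  by apply: contra vY => /eqP <-.
- rewrite !reverse_on_out ?co //.
  by apply: contra bZ; exact: YZ.
Qed.

(** As [d] precedes [v], the inequality puts more than half of [Y] before [v]. Reversing [Z] then
    does not move [v] up, which preserves its arcs to vertices outside [Z]. *)
Lemma reverse_ext c d : c \in linear_exts o -> (d, v) \in o ->
    #|Y| <= rank_in Y c v + rank_in Y c d ->
  reverse_on Z c \in linear_exts flip_below.
Proof.
move=> /linear_extsP[cI co] dv H; have rI := @reverse_on_inj _ Z c cI.
have lev : reverse_on Z c v <= c v.
  rewrite leqNgt; apply/negP => ltv.
  (* [b] held the position that [v] receives. The ranks of [v] in [Y] before and after add up to
     [#|Y|], which excludes a rise. *)
  have [b bZ cb] := reverse_on_val c vZ.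
  have := rank_in_ltn b cI vZ; rewrite -cb ltv.
  rewrite -(rank_in_im cI rI (reverse_on_im _ _) cb) !rank_in_setU1 //.
  have : rank_in Y c d < rank_in Y c v by rewrite rank_in_ltn ?belowY //; exact: co.
  by have := rank_reverse cI vZ; rewrite (negbTE vY); lia.
apply/linear_extsP; split=> // a b /flip_below_arc[[aY bY ba]|[-> bY bv]|[aY bZ ab]].
- by rewrite reverse_on_lt ?YZ // co.
- by rewrite reverse_on_lt ?vZ ?YZ // co.
- rewrite (reverse_on_out cI bZ).
  have [av|av] := eqVneq a v; last by rewrite reverse_on_out ?co // !inE negb_or av.
  by rewrite av in ab *; apply: leq_ltn_trans lev (co _ _ ab).
Qed.

(** The branch depends on whether reversing [Y] succeeds; [flip_map_cross] turns this into
    disjointness of the two images. *)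
Definition flip_map c :=
  if reverse_on Y c \in linear_exts flip_below then reverse_on Y c else reverse_on Z c.

Lemma flip_map_ext c : c \in linear_exts o -> flip_map c \in linear_exts flip_below.
Proof.
move=> co; rewrite /flip_map; case: ifP => // /negP rc.
case: (pickP (fun d => ((d, v) \in o) && (#|Y| <= rank_in Y c v + rank_in Y c d))).
  by move=> d /andP[dv]; exact: reverse_ext.
move=> H; case: rc; apply: reverse_below_ext => // d dv.
by rewrite ltnNge; move: (H d); rewrite dv /= => ->.
Qed.

(** From [c] to [c'] the rank of [v] in [Y] is complemented to [#|Y|], while that of [d] is
    unchanged. Since [d] precedes [v] in [c], the rank sum in [c'] is below [#|Y|]. *)
Lemma flip_map_cross c c' : c \in linear_exts o -> c' \in linear_exts o ->
  reverse_on Y c = reverse_on Z c' -> reverse_on Y c' \in linear_exts flip_below.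
Proof.
move=> co /[dup] c'o /linear_extsP[c'I _] E; apply: reverse_below_ext => // d dv.
move: co => /linear_extsP[cI co]; have dY := belowY dv.
have : rank_in Y c d < rank_in Y c v by rewrite rank_in_ltn //; exact: co.
have := rank_reverse_below cI dY; have := rank_reverse_below_v cI.
have := rank_reverse c'I vZ; have := rank_reverse c'I (YZ dY).
rewrite E dY (negbTE vY); lia.
Qed.

Lemma flip_map_inj : {in linear_exts o &, injective flip_map}.
Proof.
move=> c c' co c'o; rewrite /flip_map; case: ifP => H; case: ifP => H' E.
- exact: inv_inj (@reverse_onK _ Y) _ _ E.
- by rewrite (flip_map_cross co c'o E) in H'.
- by rewrite (flip_map_cross c'o co (esym E)) in H.
- exact: inv_inj (@reverse_onK _ Z) _ _ E.
Qed.

(** [w] puts [v] first and [Y] last: neither reversal brings it back into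
    [linear_exts o]. *)
Lemma flip_map_missed c d u : c \in linear_exts o -> (d, v) \in o -> (v, u) \in o ->
  exists2 w, w \in linear_exts flip_below &
    forall c', c' \in linear_exts o -> flip_map c' <> w.
Proof.
move=> /linear_extsP[cI co] dv vu; have dY := belowY dv.
have YNv a : a \in Y -> a != v by apply: contraTneq => ->.
have uY : u \notin Y by apply: contra vY; exact: inY.
have uv : u != v by apply: contra vY => /eqP uv; apply: belowY; rewrite -[X in (_, X)]uv.
(* The keys are 0 for [v], between 1 and [#|Pi|] for the rest outside [Y], and larger on [Y], where
   the order of [c] is reversed as the flipped arcs demand. *)
pose k a : nat := if a == v then 0 else
  if a \in Y then (#|Pi| + (#|Pi| - c a)).+1 else (c a).+1.
have cN a : c a < #|Pi| by exact: ltn_ord.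
have kI : injective k.
  move=> a b; rewrite /k; case: eqP => [->|_]; case: eqP => [->|_] //; do ?by case: ifP.
  have := cN a; have := cN b => lb la.
  by case: ifP => _; case: ifP => _ E; apply/cI/ord_inj; lia.
have [w [wI wk]] := linear_order_of_key kI.
have wv a : (w a < w v) = false by rewrite wk /k eqxx ltn0.
have wvd : w v < w d by rewrite wk /k eqxx dY (negbTE (YNv _ dY)).
exists w.
  apply/linear_extsP; split=> // a b /flip_below_arc[[aY bY ba]|[-> bY bv]|[aY bZ ab]].
  - rewrite wk /k aY bY (negbTE (YNv _ aY)) (negbTE (YNv _ bY)).
    by have := co _ _ ba; have := cN a; have := cN b; lia.
  - by rewrite wk /k eqxx bY (negbTE (YNv _ bY)).
  - move: bZ; rewrite !inE negb_or => /andP[/negbTE bv /negbTE bY].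
    by rewrite wk /k bv bY (negbTE aY); case: eqP => // _; rewrite ltnS co.
move=> c' /linear_extsP[c'I c'o]; rewrite /flip_map; case: ifP => _ E.
  (* If [w] came from reversing [Y], then [v] would be first in [c'], against the arc from [d]. *)
  have := c'o _ _ dv; rewrite -(reverse_onK Y c') E.
  have [b _ ->] := reverse_on_val w dY.
  by rewrite (reverse_on_out wI vY) wv.
(* If [w] came from reversing [Z], then [v] would have in [c'] a position that [Y] has in [w], after
   [u], against the arc to [u]. *)
have := c'o _ _ vu; rewrite -(reverse_onK Z c') E (@reverse_on_out _ _ _ u wI).
  have [b bZ Eb] := reverse_on_val w vZ; rewrite Eb.
  move: bZ; rewrite in_setU1 => /orP[/eqP bv|bY].
    (* [v] cannot keep its first place, because the reversal puts [d] before it. *)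
    have := reverse_on_lt w vZ (YZ dY); have := reverse_on_lt w (YZ dY) vZ.
    have [b' _ Eb'] := reverse_on_val w (YZ dY).
    by rewrite Eb Eb' bv wv wvd.
  rewrite wk /k bY (negbTE uY) (negbTE uv) (negbTE (YNv _ bY)).
  by have := cN u; lia.
by rewrite !inE negb_or uv.
Qed.

Lemma flip_below_more c d u : c \in linear_exts o -> (d, v) \in o -> (v, u) \in o ->
  #|linear_exts o| < #|linear_exts flip_below|.
Proof.
move=> co dv vu; have [w wo' wP] := flip_map_missed co dv vu.
rewrite -(card_in_imset flip_map_inj); apply/proper_card/properP; split.
  by apply/fintype.subsetP => _ /imsetP[c' c'o ->]; exact: flip_map_ext.
exists w => //; apply/negP => /imsetP[c' c'o E]; exact: (wP _ c'o).
Qed.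

End Flip.

(** * Acyclic orientations, and the flip in a tree *)

Section Orientations.
Variable Pi : finType.
Implicit Types (e : rel Pi) (o : {set Pi * Pi}) (c : {ffun Pi -> 'I_#|Pi|}).

Lemma acyclic_of_potential o (h : Pi -> nat) :
  (forall a b, (a, b) \in o -> h a < h b) -> is_acyclic o.
Proof.
move=> ho [//|x p] _; apply/negP => /= xp.
have : path (fun a b => h a < h b) x (rcons p x).
  by apply: sub_path xp => a b; exact: ho.
move=> /(order_path_min (fun _ _ _ => @ltn_trans _ _ _)) /allP/(_ x).
by rewrite mem_rcons inE eqxx ltnn => /(_ isT).
Qed.

(** In an acyclic orientation the number of ancestors strictly increases along arcs, so sorting by
    it gives an extension. *)
Lemma acyclic_linear_ext o : is_acyclic o -> exists c, c \in linear_exts o.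
Proof.
move=> ao; pose r a b := (a, b) \in o; pose h a := #|[set b | connect r b a]%SET|.
have hP a b : (a, b) \in o -> h a < h b.
  move=> ab; apply/proper_card/properP; split.
    apply/fintype.subsetP => x; rewrite !inE => /connect_trans; apply.
    exact: connect1.
  exists b; rewrite !inE ?connect0 //; apply/negP => /connectP[p bp E].
  have /negP[] : ~~ cycle r (b :: p) by exact: ao.
  by rewrite /= rcons_path bp -E.
(* Lexicographic key: [enum_rank], being below [#|Pi|], only breaks ties of [h]. *)
pose k a := h a * #|Pi| + enum_rank a.
have kI : injective k.
  move=> a b /(congr1 (fun n => n %% #|Pi|)).
  by rewrite !modnMDl !modn_small // => /ord_inj/enum_rank_inj.
have [c [cI ck]] := linear_order_of_key kI.
exists c; apply/linear_extsP; split=> // a b /hP ab; rewrite ck /k.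
apply: (@leq_trans ((h a).+1 * #|Pi|)).
  by rewrite mulSn addnC ltn_add2r ltn_ord.
by apply: leq_trans (leq_addr _ _); rewrite leq_mul2r ab orbT.
Qed.

Lemma linear_exts_rev o o' : (forall a b, (a, b) \in o' -> (b, a) \in o) ->
  #|linear_exts o| <= #|linear_exts o'|.
Proof.
move=> oo'; pose f c : {ffun Pi -> 'I_#|Pi|} := [ffun a => rev_ord (c a)].
have fI : injective f.
  move=> c c' /ffunP E; apply/ffunP => a; have := E a.
  by rewrite !ffunE => /rev_ord_inj.
rewrite -[X in X <= _](card_imset _ fI); apply/subset_leq_card/fintype.subsetP.
move=> _ /imsetP[c /linear_extsP[cI co] ->]; apply/linear_extsP; split.
  by move=> a b; rewrite !ffunE => /rev_ord_inj/cI.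
move=> a b /oo'/co; rewrite !ffunE /= => ba.
by apply: ltn_sub2l; rewrite ?ltnS //; exact: leq_ltn_trans ba (ltn_ord _).
Qed.

Lemma Or_arc e o a b : o \in Or e -> ((a, b) \in o) = e a b && ((b, a) \notin o).
Proof. by rewrite inE => /andP[/forallP/(_ a)/forallP/(_ b)/eqP]. Qed.

Lemma Or_acyclic e o : o \in Or e -> is_acyclic o.
Proof. by rewrite inE => /andP[_ /asboolP]. Qed.

Lemma OrP e o : (forall a b, ((a, b) \in o) = e a b && ((b, a) \notin o)) ->
  is_acyclic o -> o \in Or e.
Proof.
move=> oe oa; rewrite inE; apply/andP; split; last exact/asboolP.
by apply/forallP => a; apply/forallP => b; apply/eqP.
Qed.

(** A path from [d] to [u] avoiding [v], once shortened, would close up through [v] to a simple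
    cycle. *)
Lemma tree_neighbours_separated e v d u : is_tree e -> e v d -> e v u -> d != u ->
  ~~ connect (fun a b => [&& e a b, a != v & b != v]) d u.
Proof.
move=> [_ [es ei] _ ec] vd vu du; apply/negP => /connectP[p dp E].
move: E; case: (shortenP dp) => q dq uq _ E.
have dv : d != v by apply: contraTneq vd => ->; rewrite ei.
have vq : v \notin q.
  elim: q d {dp vd du uq E dv} dq => //= x q IH d /andP[/and3P[_ _ xv] xq].
  by rewrite inE negb_or eq_sym xv (IH x).
have /negP[] : ~~ cycle e [:: v, d & q].
  apply: ec; first by move: uq; rewrite /= inE negb_or eq_sym dv vq.
  (* [d != u] makes [q] nonempty, so the cycle has at least three vertices. *)
  by case: q E {dq uq vq} => //= E; rewrite E eqxx in du.
rewrite /= vd rcons_path -E es vu andbT.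
by apply: sub_path dq => a b /and3P[].
Qed.

Lemma flip_more_linear_exts e o d v u : is_tree e -> o \in Or e ->
    (d, v) \in o -> (v, u) \in o ->
  exists2 o', o' \in Or e & #|linear_exts o| < #|linear_exts o'|.
Proof.
move=> te oe dv vu; have [_ [es ei] _ _] := te.
pose ev a b := [&& e a b, a != v & b != v].
pose Y := [set y | [exists d, ((d, v) \in o) && connect ev d y]]%SET.
have oE a b : (a, b) \in o -> e a b by rewrite (Or_arc _ _ oe) => /andP[].
have neq a b : (a, b) \in o -> a != b.
  by move=> /oE; apply: contraTneq => ->; rewrite ei.
have sv a b : connect ev a b -> a != v -> b != v.
  move=> /connectP[p + ->]; elim: p a => //= x p IH a /andP[/and3P[_ _ xv] xp] _.
  exact: IH xp xv.
have vY : v \notin Y.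
  rewrite inE; apply/negP => /existsP[x /andP[/neq xv /sv/(_ xv)]].
  by rewrite eqxx.
have belowY a : (a, v) \in o -> a \in Y.
  by move=> av; rewrite inE; apply/existsP; exists a; rewrite av connect0.
have stepY a b : e a b -> a \in Y -> b != v -> b \in Y.
  rewrite !inE => ab /existsP[x /andP[xv xa]] bv; apply/existsP; exists x.
  rewrite xv (connect_trans xa) // connect1 // /ev ab bv andbT /=.
  exact: sv xa (neq _ _ xv).
have inY a b : (a, b) \in o -> b \in Y -> a \in Y.
  move=> ab bY; have [av|av] := eqVneq a v; last first.
    by apply: stepY bY av; rewrite es oE.
  (* Here [b] would be an upper neighbour of [v] in the branch of a lower neighbour [x]; the tree
     keeps these apart. *)
  move: bY; rewrite inE => /existsP[x /andP[xv xb]].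
  rewrite av in ab; have /negP[] : ~~ connect ev x b.
    apply: tree_neighbours_separated; rewrite ?(oE _ _ ab) ?(es v) ?(oE _ _ xv) //.
    by apply: contraTneq xv => ->; rewrite (Or_arc _ _ oe) ab andbF.
  exact: xb.
have outY a b : (a, b) \in o -> a \in Y -> (b \in Y) || (b == v).
  move=> ab aY; have [->|bv] := eqVneq b v; rewrite ?orbT // orbF.
  exact: stepY (oE _ _ ab) aY bv.
have [c co] := acyclic_linear_ext (Or_acyclic oe).
have lt := flip_below_more vY inY outY belowY co dv vu.
exists (flip_below o v Y) => //; apply: OrP.
  move=> a b; rewrite !flip_belowE (andbC (b \in _)); case: ifP => _.
    by rewrite (Or_arc b a oe) es.
  exact: Or_arc.
(* The strict inequality supplies an extension of the flipped orientation, whose positions are a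
   potential proving acyclicity. *)
have /card_gt0P[w /linear_extsP[_ wo]] := leq_ltn_trans (leq0n _) lt.
exact: acyclic_of_potential wo.
Qed.

End Orientations.

(** * Principal orientations *)

Section Principal.
Variables (Pi : finType) (e : rel Pi).
Hypothesis es : symmetric e.
Implicit Types (o : {set Pi * Pi}) (P : {set Pi}).

Lemma principal_decompositionC P1 P2 :
  principal_decomposition e P1 P2 -> principal_decomposition e P2 P1.
Proof.
move=> [U D E]; split; first by rewrite finset.setUC.
  by rewrite disjoint_sym.
by move=> a b /E[].
Qed.

Lemma principal_decomposition_compl P1 P2 a :
  principal_decomposition e P1 P2 -> (a \in P2) = (a \notin P1).
Proof.
move=> [/setP/(_ a) U D _]; move: U; rewrite !inE.
have [/(disjointFr D)|_ /=] := boolP (a \in P1); by [].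
Qed.

Lemma principal_decomposition_edge P1 P2 a b :
  principal_decomposition e P1 P2 -> e a b -> (b \in P1) = (a \notin P1).
Proof.
move=> D ab; have [_ _ /(_ _ _ ab)] := D.
rewrite !(principal_decomposition_compl _ D).
by case: (a \in P1); case: (b \in P1) => // -[n1 n2]; [case: n1 | case: n2].
Qed.

Lemma principal_orientationE P1 P2 a b : principal_decomposition e P1 P2 ->
  ((a, b) \in principal_orientation e P1 P2) = e a b && (a \in P1).
Proof.
move=> D; rewrite inE /=; case ab: (e a b) => //=.
rewrite (principal_decomposition_compl _ D) (principal_decomposition_edge D ab).
by rewrite negbK andbb.
Qed.

Lemma principal_orientation_Or P1 P2 : principal_decomposition e P1 P2 ->
  principal_orientation e P1 P2 \in Or e.
Proof.
move=> D; apply: OrP.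
  move=> a b; rewrite !principal_orientationE // (es b).
  by case ab: (e a b) => //=; rewrite (principal_decomposition_edge D ab) negbK.
(* The indicator of lying outside [P1] increases along every arc. *)
apply: (@acyclic_of_potential _ _ (fun a => a \notin P1 : nat)) => a b.
rewrite principal_orientationE // => /andP[ab aP1].
by rewrite (principal_decomposition_edge D ab) aP1.
Qed.

(** Without mixed vertices each vertex is a source or a sink, and these alternate along edges as
    [P1] and [P2] do; connectedness spreads the pattern from [a0]. *)
Lemma source_principal P1 P2 o a0 :
    (forall a b, connect e a b) -> principal_decomposition e P1 P2 -> o \in Or e ->
    (forall d v u, (d, v) \in o -> (v, u) \in o -> False) ->
    (forall b, if a0 \in P1 then (b, a0) \notin o else (a0, b) \notin o) ->
  o = principal_orientation e P1 P2.
Proof.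
move=> ce D oe nomix good0.
have good a : forall b, if a \in P1 then (b, a) \notin o else (a, b) \notin o.
  have /connectP[p ap ->] := ce a0 a.
  elim: p a0 ap good0 => //= x p IH y /andP[yx xp] good; apply: IH xp _ => b.
  have := good x; rewrite (principal_decomposition_edge D yx).
  case: ifP => _ /= nyx; apply/negP => H.
    by have := nomix y x b; rewrite (Or_arc _ _ oe) yx nyx; apply.
  have xy : (x, y) \in o by rewrite (Or_arc _ _ oe) es yx.
  by apply: nomix H xy.
apply/setP => -[a b]; rewrite principal_orientationE //.
case ab: (e a b); last by rewrite (Or_arc _ _ oe) ab.
have := good a b; case: ifP => _ /= H; last exact/negbTE.
by rewrite (Or_arc _ _ oe) ab H.
Qed.

Lemma unmixed_principal P1 P2 o : is_tree e -> principal_decomposition e P1 P2 ->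
    o \in Or e -> (forall d v u, (d, v) \in o -> (v, u) \in o -> False) ->
  o = principal_orientation e P1 P2 \/ o = principal_orientation e P2 P1.
Proof.
move=> [/card_gt0P[a0 _] _ ce _] D oe nomix.
have D' := principal_decompositionC D.
have src P Q : principal_decomposition e P Q ->
    (forall b, if a0 \in P then (b, a0) \notin o else (a0, b) \notin o) ->
  o = principal_orientation e P Q by move=> DPQ; apply: source_principal.
(* With an incoming arc [a0] is a sink, otherwise a source; its side then selects the
   orientation. *)
have [/existsP[d da0]|nin] := boolP [exists d, (d, a0) \in o].
  have nout b : (a0, b) \notin o by apply/negP; exact: nomix da0.
  have [aP|aP] := boolP (a0 \in P1); [right|left]; apply: src => // b.
    by rewrite (principal_decomposition_compl _ D) aP nout.
  by rewrite (negbTE aP) nout.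
move/existsPn: nin => nin.
have [aP|aP] := boolP (a0 \in P1); [left|right]; apply: src => // b.
  by rewrite aP nin.
by rewrite (principal_decomposition_compl _ D) aP nin.
Qed.

Lemma principal_linear_exts P1 P2 : principal_decomposition e P1 P2 ->
  #|linear_exts (principal_orientation e P1 P2)| <=
  #|linear_exts (principal_orientation e P2 P1)|.
Proof.
move=> D; apply: linear_exts_rev => a b.
by rewrite !inE /= es => /and3P[-> -> ->].
Qed.

End Principal.

(** * Cones as acyclic orientations, chambers as linear orders *)

Section Cones.
Local Open Scope classical_set_scope.
Local Open Scope ring_scope.
Variables (R : realType) (Pi : finType).
Implicit Types (e : rel Pi) (o : {set Pi * Pi}) (c : {ffun Pi -> 'I_#|Pi|}).

Local Notation V := (VPi R Pi).
Local Notation point x := (\pi_(VPi R Pi) (x : coords R Pi))%qT.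

Lemma lambda_continuous a b : continuous (@lambda R Pi a b : V -> R).
Proof.
apply/quotient_continuous.
rewrite (_ : _ \o _ = fun x : coords R Pi => x a - x b); last first.
  by apply/funext => x; exact: lambda_pi.
move=> x.
have H d : (fun y : coords R Pi => y d) @ x --> x d.
  exact: (@proj_continuous Pi (fun=> R) d x).
exact: (cvgB (H a) (H b)).
Qed.

Lemma lambdaC a b (v : V) : lambda a b v = - lambda b a v.
Proof. by rewrite /lambda opprB. Qed.

Lemma continuous_into_coords (T : topologicalType) (f : T -> coords R Pi) :
  (forall a, continuous (fun t => f t a)) -> continuous f.
Proof.
move=> fc t; apply/cvg_sup => a; move: t.
exact: (@continuous_comp_initial _ _ _ (proj a) f (fc a)).
Qed.

Lemma segment_connected_VPi (x y : coords R Pi) :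
  connected ((fun t : R => point (fun a => x a + t * (y a - x a))) @` `[0, 1]).
Proof.
apply: connected_continuous_connected; first exact: segment_connected.
apply: continuous_subspaceT => t.
pose f (t : R) : coords R Pi := fun a => x a + t * (y a - x a).
apply: (@continuous_comp _ _ _ f (\pi_(VPi R Pi))%qT t); last exact: pi_continuous.
apply: continuous_into_coords => a s; apply: cvgD; first exact: cvg_cst.
by apply: cvgM; [exact: cvg_id|exact: cvg_cst].
Qed.

Lemma lambda_nz e (v : V) a b : complement R e v -> e a b -> lambda a b v != 0.
Proof. by move=> cv ab; apply/eqP => E; apply: cv; exists (a, b). Qed.

Lemma cone_of_complement e o : o \in Or e -> cone_of R o `<=` complement R e.
Proof.
move=> oe v ov [[a b] /= ab ab0]; have [ao|ao] := boolP ((a, b) \in o).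
  by have := ov _ _ ao; rewrite ab0 ltxx.
have := Or_arc a b oe; rewrite ab (negbTE ao) /= => /esym/negbFE/ov.
by rewrite lambdaC ab0 oppr0 ltxx.
Qed.

(** By intermediate values, [lambda a b] for an edge keeps its sign on a connected part of the
    complement. Conversely the cone is convex, so segments join its points. *)
Lemma cone_component e o (v : V) : o \in Or e -> cone_of R o v ->
  connected_component (complement R e) v = cone_of R o.
Proof.
move=> oe ov; apply/seteqP; split => [w vw a b ab|w ow].
  have eab : e a b by move: ab; rewrite (Or_arc a b oe) => /andP[].
  have : connected (lambda a b @` connected_component (complement R e) v).
    apply: connected_continuous_connected; first exact: component_connected.
    exact/continuous_subspaceT/lambda_continuous.
  move=> /connected_intervalP itv; rewrite ltNge; apply/negP => w0.
  have /(itv _ _) : (lambda a b @` connected_component (complement R e) v)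
      (lambda a b v).
    by exists v => //; apply/connected_component_refl/(cone_of_complement oe).
  have wi : (lambda a b @` connected_component (complement R e) v)
      (lambda a b w) by exists w.
  have b0 : lambda a b v <= 0 <= lambda a b w by rewrite w0 ltW // ov.
  move=> /(_ _ wi _ b0)[u /connected_component_sub cu u0].
  by have := lambda_nz cu eab; rewrite u0 eqxx.
pose x := repr v : coords R Pi; pose y := repr w : coords R Pi.
suff: ((fun t : R => point (fun a => x a + t * (y a - x a))) @` `[0, 1]) w.
  apply: connected_component_max; last exact: segment_connected_VPi.
- exists 0; first by rewrite /= in_itv /= lexx ler01.
  by rewrite -[RHS]reprK; congr (\pi _)%qT; apply/funext => a; rewrite mul0r addr0.
- move=> _ [t /= + <-]; rewrite in_itv /= => /andP[t0 t1].
  apply: (cone_of_complement oe) => a b ab; rewrite lambda_pi.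
  have := ov _ _ ab; have := ow _ _ ab; rewrite /lambda -/x -/y => yab xab.
  rewrite (_ : _ - _ = (1 - t) * (x a - x b) + t * (y a - y b)); last by ring.
  (* One summand must be strictly negative: the first at [t = 0], otherwise the second. *)
  move: t0; rewrite le_eqVlt => /predU1P[<-|t0].
    by rewrite mul0r addr0 subr0 mul1r.
  rewrite -[ltRHS]addr0; apply: ler_ltD; last by rewrite pmulr_rlt0.
  by rewrite mulr_ge0_le0 ?subr_ge0 // ltW.
- exists 1; first by rewrite /= in_itv /= lexx ler01.
  by rewrite -[RHS]reprK; congr (\pi _)%qT; apply/funext => a; rewrite mul1r addrC subrK.
Qed.

Lemma linear_ext_cone o c : c \in linear_exts o ->
  cone_of R o (point (fun a => (c a)%:R)).
Proof.
move=> /linear_extsP[_ co] a b /co ab.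
by rewrite lambda_pi subr_lt0 ltr_nat.
Qed.

Lemma cone_of_nonempty e o : o \in Or e -> cone_of R o !=set0.
Proof.
move=> /Or_acyclic/acyclic_linear_ext[c /linear_ext_cone]; exact: ex_intro.
Qed.

(** An arc of [o'] reversed in [o] would force one form to be both positive and negative at a point
    of the smaller cone. *)
Lemma cone_of_subset e o o' :
  (forall a b, (a, b) \in o' -> e a b) -> o \in Or e ->
  cone_of R o `<=` cone_of R o' -> {subset o' <= o}.
Proof.
move=> o'e oe sub [a b] ab; rewrite (Or_arc a b oe) o'e //=; apply/negP => ba.
have [v ov] := cone_of_nonempty oe.
have := ov _ _ ba; rewrite lambdaC oppr_lt0 => /lt_trans/(_ (sub _ ov _ _ ab)).
by rewrite ltxx.
Qed.

(** The signs of the forms at a point of the complement orient the edges; coordinates increase along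
    the arcs, which excludes cycles. *)
Lemma conesE e : symmetric e ->
  cones R e = [set cone_of R o | o in [set` Or e]].
Proof.
move=> es; apply/seteqP; split=> [_ [v cv <-]|_ [o /= oe <-]]; last first.
  have [v ov] := cone_of_nonempty oe; exists v; first exact: (cone_of_complement oe).
  exact: cone_component.
pose o := [set ab : Pi * Pi | e ab.1 ab.2 && (lambda ab.1 ab.2 v < 0)]%SET.
have oE a b : (a, b) \in o = e a b && (lambda a b v < 0) by rewrite inE.
have ov : cone_of R o v by move=> a b; rewrite oE => /andP[].
have oe : o \in Or e.
  apply: OrP => [a b|].
    rewrite !oE (es b); case ab: (e a b) => //=.
    by rewrite -leNgt lambdaC oppr_lt0 lt0r (lambda_nz cv) // es.
  move=> [//|x p] _; apply/negP => /= xp.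
  pose y := repr v : coords R Pi.
  have : path (fun a b => y a < y b) x (rcons p x).
    by apply: sub_path xp => a b; rewrite oE -[(y a < y b)%R]subr_lt0 => /andP[].
  move=> /(order_path_min (fun _ _ _ => @lt_trans _ _ _ _ _)) /allP/(_ x).
  by rewrite mem_rcons inE eqxx ltxx => /(_ isT).
exists o => //; exact/esym/cone_component.
Qed.

(** For injective [c], the linear order seen as an acyclic orientation of the complete graph, whose
    cones are the chambers. *)
Definition order_arcs c : {set Pi * Pi} :=
  [set ab : Pi * Pi | (c ab.1 < c ab.2)%N]%SET.

Lemma order_arcsE c a b : ((a, b) \in order_arcs c) = (c a < c b)%N.
Proof. by rewrite inE. Qed.

Let K : rel Pi := fun a b => a != b.

Lemma order_arcs_Or c : injective c -> order_arcs c \in Or K.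
Proof.
move=> cI; apply: OrP => [a b|].
  rewrite !order_arcsE -leqNgt ltn_neqAle; congr (_ && _).
  by rewrite (inj_eq val_inj) (inj_eq cI).
by apply: (@acyclic_of_potential _ _ (fun a => c a)) => a b; rewrite order_arcsE.
Qed.

Lemma Or_complete p : p \in Or K ->
  exists2 c : {ffun Pi -> 'I_#|Pi|}, injective c & p = order_arcs c.
Proof.
move=> pK; have [c /linear_extsP[cI co]] := acyclic_linear_ext (Or_acyclic pK).
exists c => //; apply/setP => -[a b]; rewrite order_arcsE.
apply/idP/idP => [/co//|ab]; rewrite (Or_arc a b pK); apply/andP; split.
  by apply: contraTneq ab => ->; rewrite ltnn.
by apply: contraL ab => /co; rewrite -leqNgt; exact: ltnW.
Qed.

Lemma chambersE o : (forall a b, (a, b) \in o -> a != b) ->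
  [set C | chambers (R := R) (Pi := Pi) C /\ C `<=` cone_of R o] =
  [set cone_of R (order_arcs c) | c in [set` linear_exts o]].
Proof.
move=> oK; rewrite /chambers conesE; last by move=> a b; rewrite eq_sym.
apply/seteqP; split=> [_ [[p /= pK <-]] sub|_ [c /= co <-]].
  have [c cI pc] := Or_complete pK; exists c; rewrite -?pc //=.
  apply/linear_extsP; split=> // a b ab; rewrite -order_arcsE -pc.
  exact: (cone_of_subset oK pK sub).
have /linear_extsP[cI cP] := co; split.
  by exists (order_arcs c) => //=; exact: order_arcs_Or.
by move=> v cv a b /cP ab; apply: cv; rewrite order_arcsE.
Qed.

(** Distinct orders give distinct chambers: a cone determines its arcs, and the comparisons
    determine the order. *)
Lemma sigmaE o : (forall a b, (a, b) \in o -> a != b) ->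
  sigma R o = #|linear_exts o|.
Proof.
move=> oK; rewrite /sigma /nchambers chambersE //.
rewrite fset_set_image; last exact: finite_finset.
rewrite card_in_imfset /=; last first.
  move=> c c'; rewrite !in_fset_set ?inE //=.
  move=> /linear_extsP[cI _] /linear_extsP[c'I _] E.
  have sub (d d' : {ffun Pi -> 'I_#|Pi|}) : injective d -> injective d' ->
      cone_of R (order_arcs d) = cone_of R (order_arcs d') ->
      forall a b, (d' a < d' b)%N -> (d a < d b)%N.
    move=> dI d'I dd' a b; rewrite -!order_arcsE; apply: (cone_of_subset (e := K)).
    - by move=> {}a {}b; rewrite (Or_arc _ _ (order_arcs_Or d'I)) => /andP[].
    - exact: order_arcs_Or.
    - by rewrite dd'.
  apply: eq_linear_order => // a b; apply/idP/idP; apply: sub => //.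
rewrite -[RHS]card_finset; congr #|` _|; apply/fsetP => c.
rewrite in_fset_set; last exact: finite_finset.
apply/idP/idP => [/set_mem|cL]; [|apply/mem_set]; first by rewrite /= !inE.
by move: cL; rewrite /= !inE.
Qed.

End Cones.

(** * The principal orientations as the only maximisers *)

Local Open Scope classical_set_scope.

Theorem theorem3p2 (R : realType) (Pi : finType) (e : rel Pi)
    (P1 P2 : {set Pi}) (tree_e : is_tree e)
    (decP : principal_decomposition e P1 P2) :
  (forall o : {set Pi * Pi}, o \in Or e ->
     (sigma R o = sigma_max R e <->
      o = principal_orientation e P1 P2 \/ o = principal_orientation e P2 P1))
  /\
  [set E : set (VPi R Pi) | cones R e E /\
     forall E', cones R e E' ->
      (nchambers E' <= nchambers E)%N] =
  [set cone_of R (principal_orientation e P1 P2);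
       cone_of R (principal_orientation e P2 P1)].
Proof.
have [_ [es ei] _ _] := tree_e.
have decP' := principal_decompositionC decP.
have O12 := principal_orientation_Or es decP.
have O21 := principal_orientation_Or es decP'.
have sE o : o \in Or e -> sigma R o = #|linear_exts o|.
  move=> oe; apply: sigmaE => a b; rewrite (Or_arc a b oe) => /andP[ab _].
  by apply: contraTneq ab => ->; rewrite ei.
have le_max o : o \in Or e -> sigma R o <= sigma_max R e.
  by move=> oe; apply: (@leq_bigmax_cond _ _ (sigma R)).
have max_principal o : o \in Or e -> sigma R o = sigma_max R e ->
    o = principal_orientation e P1 P2 \/ o = principal_orientation e P2 P1.
  move=> oe om; apply: unmixed_principal => // d v u dv vu.
  have [o' oe' lt] := flip_more_linear_exts tree_e oe dv vu.
  by have := le_max _ oe'; rewrite -om !sE // leqNgt lt.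
have eq12 : sigma R (principal_orientation e P1 P2) =
    sigma R (principal_orientation e P2 P1).
  by apply/eqP; rewrite eqn_leq !sE // !principal_linear_exts.
have principal_max : sigma R (principal_orientation e P1 P2) = sigma_max R e.
  (* The maximum is attained, necessarily at a principal orientation, and both of these have the
     same value. *)
  have [|o oe om] := @eq_bigmax_cond _ (mem (Or e)) (sigma R).
    by apply/card_gt0P; exists (principal_orientation e P1 P2).
  by case: (max_principal o oe (esym om)) => oP; rewrite /sigma_max om oP.
have maxP o : o \in Or e -> (sigma R o = sigma_max R e <->
    o = principal_orientation e P1 P2 \/ o = principal_orientation e P2 P1).
  move=> oe; split; first exact: max_principal.
  by case=> ->; rewrite -?eq12.
(* Every cone is some [cone_of R o], with [sigma R o] chambers, so the geometric claim reduces to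
   the one on orientations. *)
split=> //; rewrite conesE //; apply/seteqP; split=> [E [[o /= oe <-] oM]|].
  have /(maxP _ oe)[->|->] : sigma R o = sigma_max R e; [|by left|by right].
  apply/eqP; rewrite eqn_leq le_max // -principal_max; apply: oM.
  by exists (principal_orientation e P1 P2).
have isM o : o \in Or e -> sigma R o = sigma_max R e ->
    [set cone_of R o | o in [set` Or e]] (cone_of R o) /\
    forall E', [set cone_of R o | o in [set` Or e]] E' ->
      (nchambers E' <= nchambers (cone_of R o))%N.
  move=> oe om; split; first by exists o.
  by move=> _ [o' /= oe' <-]; rewrite -/(sigma R o) om; exact: le_max.
by move=> _ [->|->]; apply: isM; rewrite // -eq12.
Qed.
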